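(* For any integers $d,d'\ge 1$, $$\omega^{[d]}\omega^{[d']}=\omega^{[d']}\omega^{[d]}.$$ In particular, $\omega^{[d]}\omega=\omega\,\omega^{[d]}$; namely, the square with maps $E(t)\xrightarrow{\ \omega^{[d]}\ }H^{[d]}(t)\xrightarrow{\ \omega\ }(H^{[d]}(-t))^{-1}$ and $E(t)\xrightarrow{\ \omega\ }H(t)\xrightarrow{\ \omega^{[d]}\ }(H^{[d]}(-t))^{-1}$ commutes.
   Context: $\Lambda$ is the ring of symmetric functions over $\mathbb{Q}$ in $x=(x_1,x_2,\ldots)$. For a positive integer $d$, $H^{[d]}(t)=\sum_{n\ge 0}h_n^{[d]}(x)t^n=\prod_{k\ge 1}(1+x_kt+x_k^2t^2+\cdots+x_k^dt^d)$. $E(t)=H^{[1]}(t)=\sum_n e_nt^n$ and $H(t)=E(-t)^{-1}=\sum_nh_nt^n$ are the generating functions of the elementary and complete homogeneous symmetric functions. $\omega^{[d]}:\Lambda\to\Lambda$ is the algebra homomorphism determined by $\omega^{[d]}(e_n)=h_n^{[d]}$ for all $n$; $\omega:\Lambda\to\Lambda$ is the algebra involution with $\omega(e_n)=h_n$ for all $n$. These maps are applied to power series in $t$ coefficientwise. *)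

(* Defs.v *)
From HB Require Import structures.
From mathcomp Require Import all_boot all_order all_algebra perm.
From mathcomp Require Import mpoly.
From mathcomp Require Import zify boolp.

Set Implicit Arguments.
Unset Strict Implicit.
Unset Printing Implicit Defensive.

Import GRing.Theory.
Local Open Scope ring_scope.

(* The specialization x_{n+1} := 0. *)
Definition trunc_vars (n : nat) : n.+1.-tuple {mpoly rat[n]} :=
  [tuple if unlift ord_max i is Some j then 'X_j else 0 | i < n.+1].
Definition mtrunc (n : nat) (p : {mpoly rat[n.+1]}) : {mpoly rat[n]} :=
  p \mPo trunc_vars n.

HB.instance Definition _ n :=
  GRing.LRMorphism.copy (@mtrunc n) (comp_mpoly (trunc_vars n)).

(* The ring of symmetric functions is the inverse limit, in the category of
   graded rings, of the rings of symmetric polynomials: f stands for the series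
   in x_1, x_2, ... such that sf f n is f(x_1, ..., x_n, 0, 0, ...), and x_i is
   'X_(i-1).  Without sf_bounded one would get infinite sums of homogeneous
   components as well. *)
Record Lambda : Type := SymFun {
  sf :> forall n : nat, {mpoly rat[n]};
  sf_sym : forall n, sf n \is symmetric;
  sf_trunc : forall n, mtrunc (sf n.+1) = sf n;
  sf_bounded : exists D, forall n, (msize (sf n) <= D)%N
}.

Lemma LambdaP (f g : Lambda) : (forall n, f n = g n) -> f = g.
Proof.
case: f g => [f f1 f2 f3] [g g1 g2 g3] /= efg.
have {efg} efg : f = g by apply: functional_extensionality_dep.
by case: _ / efg in g1 g2 g3 *; congr SymFun; apply: Prop_irrelevance.
Qed.

HB.instance Definition _ := gen_eqMixin Lambda.
HB.instance Definition _ := gen_choiceMixin Lambda.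

Section LambdaRing.

Implicit Types f g h : Lambda.

Program Definition Lambda_zero := @SymFun (fun n => 0) _ _ _.
Next Obligation. by rewrite rpred0. Qed.
Next Obligation. by rewrite raddf0. Qed.
Next Obligation. by exists 0%N => n; rewrite mmeasure0. Qed.

Program Definition Lambda_opp f := @SymFun (fun n => - f n) _ _ _.
Next Obligation. by rewrite rpredN sf_sym. Qed.
Next Obligation. by rewrite raddfN /= sf_trunc. Qed.
Next Obligation.
by case: (sf_bounded f) => D Df; exists D => n; rewrite mmeasureN.
Qed.

Program Definition Lambda_add f g := @SymFun (fun n => f n + g n) _ _ _.
Next Obligation. by rewrite rpredD ?sf_sym. Qed.
Next Obligation. by rewrite raddfD /= !sf_trunc. Qed.
Next Obligation.
have [[D Df] [D' Dg]] := (sf_bounded f, sf_bounded g).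
exists (maxn D D') => n; apply: leq_trans (mmeasureD_le _ _ _) _.
by rewrite geq_max !leq_max Df Dg orbT.
Qed.

Program Definition Lambda_one := @SymFun (fun n => 1) _ _ _.
Next Obligation. by rewrite rpred1. Qed.
Next Obligation. by rewrite rmorph1. Qed.
Next Obligation. by exists 1%N => n; rewrite mmeasure1. Qed.

Program Definition Lambda_mul f g := @SymFun (fun n => f n * g n) _ _ _.
Next Obligation. by rewrite rpredM ?sf_sym. Qed.
Next Obligation. by rewrite rmorphM /= !sf_trunc. Qed.
Next Obligation.
have [[D Df] [D' Dg]] := (sf_bounded f, sf_bounded g).
exists (D + D')%N => n.
have [->|nzf] := eqVneq (f n) 0; first by rewrite mul0r mmeasure0.
have [->|nzg] := eqVneq (g n) 0; first by rewrite mulr0 mmeasure0.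
by rewrite msizeM // (leq_trans (leq_pred _)) ?leq_add.
Qed.

Program Definition Lambda_scale (c : rat) f :=
  @SymFun (fun n => c *: f n) _ _ _.
Next Obligation. by rewrite rpredZ ?sf_sym. Qed.
Next Obligation. by rewrite linearZ /= sf_trunc. Qed.
Next Obligation.
case: (sf_bounded f) => D Df; exists D => n.
exact: leq_trans (msizeZ_le _ _) _.
Qed.

Fact Lambda_addA : associative Lambda_add.
Proof. by move=> f g h; apply: LambdaP => n /=; rewrite addrA. Qed.
Fact Lambda_addC : commutative Lambda_add.
Proof. by move=> f g; apply: LambdaP => n /=; rewrite addrC. Qed.
Fact Lambda_add0 : left_id Lambda_zero Lambda_add.
Proof. by move=> f; apply: LambdaP => n /=; rewrite add0r. Qed.
Fact Lambda_addN : left_inverse Lambda_zero Lambda_opp Lambda_add.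
Proof. by move=> f; apply: LambdaP => n /=; rewrite addNr. Qed.

HB.instance Definition _ := GRing.isZmodule.Build Lambda
  Lambda_addA Lambda_addC Lambda_add0 Lambda_addN.

Fact Lambda_mulA : associative Lambda_mul.
Proof. by move=> f g h; apply: LambdaP => n /=; rewrite mulrA. Qed.
Fact Lambda_mulC : commutative Lambda_mul.
Proof. by move=> f g; apply: LambdaP => n /=; rewrite mulrC. Qed.
Fact Lambda_mul1 : left_id Lambda_one Lambda_mul.
Proof. by move=> f; apply: LambdaP => n /=; rewrite mul1r. Qed.
Fact Lambda_mulDl : left_distributive Lambda_mul Lambda_add.
Proof. by move=> f g h; apply: LambdaP => n /=; rewrite mulrDl. Qed.
Fact Lambda_one_neq0 : Lambda_one != 0.
Proof. by apply/eqP => /(congr1 (sf^~ 0%N))/eqP; rewrite oner_eq0. Qed.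

HB.instance Definition _ := GRing.Zmodule_isComNzRing.Build Lambda
  Lambda_mulA Lambda_mulC Lambda_mul1 Lambda_mulDl Lambda_one_neq0.

Fact Lambda_scaleA a b f :
  Lambda_scale a (Lambda_scale b f) = Lambda_scale (a * b) f.
Proof. by apply: LambdaP => n /=; rewrite scalerA. Qed.
Fact Lambda_scale1 : left_id 1 Lambda_scale.
Proof. by move=> f; apply: LambdaP => n /=; rewrite scale1r. Qed.
Fact Lambda_scaleDr : right_distributive Lambda_scale +%R.
Proof. by move=> c f g; apply: LambdaP => n /=; rewrite scalerDr. Qed.
Fact Lambda_scaleDl f : {morph Lambda_scale^~ f : a b / a + b}.
Proof. by move=> a b; apply: LambdaP => n /=; rewrite scalerDl. Qed.

HB.instance Definition _ := GRing.Zmodule_isLmodule.Build rat Lambda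
  Lambda_scaleA Lambda_scale1 Lambda_scaleDr Lambda_scaleDl.

Fact Lambda_scaleAl (c : rat) f g : c *: (f * g) = (c *: f) * g.
Proof. by apply: LambdaP => n /=; rewrite scalerAl. Qed.

HB.instance Definition _ :=
  GRing.Lmodule_isLalgebra.Build rat Lambda Lambda_scaleAl.
HB.instance Definition _ := GRing.Lalgebra_isComAlgebra.Build rat Lambda.

Definition sf_at (n : nat) (f : Lambda) : {mpoly rat[n]} := f n.

Fact sf_at_zmod n : zmod_morphism (sf_at n). Proof. by []. Qed.
HB.instance Definition _ n :=
  GRing.isZmodMorphism.Build Lambda {mpoly rat[n]} (sf_at n) (sf_at_zmod n).
Fact sf_at_mul n : monoid_morphism (sf_at n). Proof. by []. Qed.
HB.instance Definition _ n :=
  GRing.isMonoidMorphism.Build Lambda {mpoly rat[n]} (sf_at n) (sf_at_mul n).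
Fact sf_at_scale n : scalable (sf_at n). Proof. by []. Qed.
HB.instance Definition _ n :=
  GRing.isScalable.Build rat Lambda {mpoly rat[n]} *:%R (sf_at n)
    (sf_at_scale n).

End LambdaRing.

(* When x_k = 0 for k > N, the factors with k > N of the infinite product
   defining H^{[d]}(t) are 1; t is the variable of the polynomial ring. *)
Definition Hd_poly (d N : nat) : {poly {mpoly rat[N]}} :=
  \prod_(k < N) \poly_(j < d.+1) ('X_k ^+ j : {mpoly rat[N]}).

Fact Hd_poly_sym d N n : (Hd_poly d N)`_n \is symmetric.
Proof.
apply/issymP => s; rewrite -(coef_map (msym s)) /Hd_poly rmorph_prod /=.
congr (nth 0 (polyseq _) n); rewrite [RHS](reindex_inj (@perm_inj _ s)) /=.
apply: eq_bigr => k _; apply/polyP => j; rewrite coef_map !coef_poly.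
case: ifP => _; last by rewrite raddf0.
rewrite -[LHS]/(msym s _) rmorphXn /=; congr (_ ^+ j).
rewrite msymX; congr 'X_[_]; apply/mnmP => i; rewrite !mnmE.
by rewrite -(inj_eq (@perm_inj _ s)) permKV.
Qed.

Fact Hd_poly_trunc d N n : mtrunc (Hd_poly d N.+1)`_n = (Hd_poly d N)`_n.
Proof.
rewrite -(coef_map (@mtrunc N)) /Hd_poly big_ord_recr /= rmorphM rmorph_prod /=.
have mtX (i : 'I_N.+1) :
    mtrunc 'X_i = if unlift ord_max i is Some j then 'X_j else 0.
  by rewrite /mtrunc comp_mpolyXU -tnth_nth tnth_mktuple.
rewrite [X in _ * X](_ : _ = 1) ?mulr1; last first.
  apply/polyP => -[|j]; rewrite coef_map coef_poly coef1 /= ?rmorph1 //.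
  by case: ifP => _; rewrite ?raddf0 // rmorphXn /= mtX unlift_none expr0n.
congr (nth 0 (polyseq _) n); apply: eq_bigr => k _; apply/polyP => j.
rewrite coef_map !coef_poly; case: ifP => _; last by rewrite raddf0.
rewrite -[LHS]/(mtrunc _) rmorphXn /= mtX; congr (_ ^+ j).
have -> : widen_ord (leqnSn N) k = lift ord_max k.
  by apply/val_inj; rewrite /= /bump leqNgt ltn_ord.
by rewrite liftK.
Qed.

Fact Hd_poly_bounded d N n : (msize (Hd_poly d N)`_n <= n.+1)%N.
Proof.
rewrite /Hd_poly; elim/big_rec: _ n => [|k q _ IH] n.
  by rewrite coef1; case: n => [|n]; rewrite ?mmeasure1 ?mmeasure0.
rewrite coefM; apply: (leq_trans (mmeasure_sum _ _ _ _)).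
apply/bigmax_leqP => i _; rewrite coef_poly.
case: ifP => _; last by rewrite mul0r mmeasure0.
have [->|nzq] := eqVneq q`_(n - i) 0; first by rewrite mulr0 mmeasure0.
have nzX : ('X_k : {mpoly rat[N]}) ^+ i != 0.
  by rewrite expf_neq0 // -(mmeasure_poly_eq0 mdeg) mmeasureX.
rewrite msizeM // mpolyXn msizeX mdegMn mdeg1 mul1n addSn /=.
apply: (@leq_trans (i + (n - i).+1)); first by rewrite leq_add2l IH.
by rewrite addnS subnKC // leq_ord.
Qed.

Definition hd (d n : nat) : Lambda :=
  SymFun (fun N => Hd_poly_sym d N n) (fun N => Hd_poly_trunc d N n)
    (ex_intro _ n.+1 (fun N => Hd_poly_bounded d N n)).

Lemma hd0 d : hd d 0 = 1.
Proof.
apply: LambdaP => N /=; rewrite /Hd_poly -horner_coef0 horner_prod big1 // => k _.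
by rewrite horner_coef0 coef_poly.
Qed.

(* Formal power series in t over A are represented by their sequences of
   coefficients. *)
Section PowerSeries.

Variable A : comNzRingType.
Implicit Types u v : nat -> A.

Definition ser_one : nat -> A := fun n => (n == 0%N)%:R.

Definition ser_mul u v : nat -> A :=
  fun n => \sum_(i < n.+1) u i * v (n - i)%N.

(* u(-t) *)
Definition ser_negt u : nat -> A := fun n => (-1) ^+ n * u n.

(* The inverse sum_k (1 - u)^k of a series u with constant term 1; the terms
   with n < k do not contribute to the coefficient of t^n. *)
Definition ser_inv u : nat -> A :=
  fun n => (\sum_(k < n.+1) (1 - \poly_(i < n.+1) u i) ^+ k)`_n.

Fact coef_exp_low (p : {poly A}) k m : p`_0 = 0 -> (m < k)%N -> (p ^+ k)`_m = 0.
Proof.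
move=> p0 ltmk; rewrite (_ : p = (\poly_(i < size p) p`_i.+1) * 'X).
  by rewrite exprMn_comm ?coefMXn ?ltmk //; apply: commr_polyX.
apply/polyP => -[|i]; rewrite coefMX //= coef_poly.
by case: ltnP => // le_pi; rewrite nth_default // ltnW.
Qed.

Fact eq_coef_exp (p q : {poly A}) k m :
  (forall j, (j <= m)%N -> p`_j = q`_j) -> (p ^+ k)`_m = (q ^+ k)`_m.
Proof.
elim: k m => [|k IH] m epq; first by rewrite !expr0.
rewrite !exprS !coefM; apply: eq_bigr => i _.
rewrite epq ?leq_ord // IH // => j lej; apply: epq.
exact: leq_trans lej (leq_subr _ _).
Qed.

Lemma ser_mulV u : u 0%N = 1 -> ser_mul u (ser_inv u) = ser_one.
Proof.
move=> u0; apply/funext => n; rewrite /ser_mul /ser_one.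
pose P := \poly_(i < n.+1) u i; pose B := 1 - P.
have B0 : B`_0 = 0 by rewrite coefB coef1 coef_poly u0 subrr.
have P_B : P * (\sum_(k < n.+1) B ^+ k) = 1 - B ^+ n.+1.
  by rewrite -[RHS]opprB subrX1 -mulNr opprB /B subKr.
transitivity ((P * (\sum_(k < n.+1) B ^+ k))`_n); last first.
  by rewrite P_B coefB coef1 coef_exp_low // subr0.
rewrite coefM; apply: eq_bigr => i _; rewrite coef_poly ltn_ord; congr (_ * _).
rewrite /ser_inv !coef_sum.
rewrite (big_ord_widen n.+1 (fun k =>
  ((1 - \poly_(i0 < (n - i).+1) u i0) ^+ k)`_(n - i))) ?ltnS ?leq_subr //.
rewrite [RHS](bigID (fun k : 'I_n.+1 => (k < (n - i).+1)%N)) /=.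
rewrite [X in _ = _ + X]big1 ?addr0 => [|k]; last first.
  by rewrite -leqNgt => ltk; rewrite coef_exp_low.
apply: eq_bigr => k _; apply: eq_coef_exp => j lej.
rewrite !coefB !coef_poly ltnS lej ltnS.
by rewrite (leq_trans lej) ?leq_subr.
Qed.

End PowerSeries.

(* Coefficientwise application of a map to a power series. *)
Definition ser_map (A B : Type) (phi : A -> B) (u : nat -> A) : nat -> B :=
  fun n => phi (u n).


Definition Hd_ser (d : nat) : nat -> Lambda := hd d.
Definition E_ser : nat -> Lambda := Hd_ser 1.
Definition H_ser : nat -> Lambda := ser_inv (ser_negt E_ser).

Definition e_ (n : nat) : Lambda := E_ser n.
Definition h_ (n : nat) : Lambda := H_ser n.

Lemma h_0 : h_ 0 = 1.
Proof. by rewrite /h_ /H_ser /ser_inv big_ord1 expr0 coef1. Qed.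

Lemma e_mesym k n : e_ k n = mesym n rat k.
Proof.
rewrite /=; elim: n k => [|n IH] k.
  rewrite /Hd_poly big_ord0 coef1; case: k => [|k]; first by rewrite mesym0E.
  by rewrite mesym_geqnE.
rewrite /Hd_poly big_ord_recr /=.
rewrite (_ : \poly_(j < 2) _ = 1 + 'X_ord_max *: 'X); last first.
  apply/polyP => -[|[|j]]; rewrite coef_poly coefD coef1 coefZ coefX /=.
  - by rewrite mulr0 addr0.
  - by rewrite mulr1 add0r.
  - by rewrite mulr0 addr0.
rewrite (_ : \prod_(i < n) _ = map_poly (@mwiden n rat) (Hd_poly 1 n)).
  rewrite mulrDr mulr1 coefD -scalerAr coefZ coefMX.
  case: k => [|k]; rewrite ?coef_map /=.
    by rewrite mulr0 addr0 -[LHS]/(mwiden _) IH !mesym0E rmorph1.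
  rewrite mesymSS -![mpoly_mwiden__canonical__GRing_RMorphism _ _ _]/(mwiden _).
  by rewrite !IH mulrC.
rewrite /Hd_poly rmorph_prod; apply: eq_bigr => i _ /=.
apply/polyP => j; rewrite coef_map !coef_poly; case: ifP => _.
  by rewrite -[RHS]/(mwiden _) rmorphXn /= mwidenX mnmwiden1.
by rewrite raddf0.
Qed.

(* Since Lambda is the polynomial algebra on e_1, e_2, ..., every sequence a
   in Lambda determines an algebra homomorphism mapping e_n to a_n for n > 0.
   To evaluate it at f, write f(x_1, ..., x_N) as a polynomial in
   e_1, ..., e_N, where N is at least the degree of f. *)
Section SymHom.

Implicit Types f g : Lambda.

Fact mpoly_rmorph_ext (N : nat) (A : comNzRingType)
    (phi psi : {rmorphism {mpoly rat[N]} -> A}) :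
  (forall c, phi c%:MP = psi c%:MP) -> (forall i, phi 'X_i = psi 'X_i) ->
  phi =1 psi.
Proof.
move=> eqC eqX t; rewrite [t]mpolyE !rmorph_sum; apply: eq_bigr => m _.
rewrite -mul_mpolyC !rmorphM eqC mpolyXE_id !rmorph_prod; congr (_ * _).
by apply: eq_bigr => i _; rewrite !rmorphXn /= eqX.
Qed.

Fact mtruncXlift N (j : 'I_N) : mtrunc 'X_(lift ord_max j) = 'X_j.
Proof. by rewrite /mtrunc comp_mpolyXU -tnth_nth tnth_mktuple liftK. Qed.

Fact widen_lift N (j : 'I_N) : widen_ord (leqnSn N) j = lift ord_max j.
Proof. by apply/val_inj; rewrite /= /bump leqNgt ltn_ord. Qed.

Fact mwiden_mtrunc N (t : {mpoly rat[N.+1]}) :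
  (forall m, m \in msupp t -> m ord_max = 0%N) -> mwiden (mtrunc t) = t.
Proof.
move=> t0; rewrite [t in LHS]mpolyE [RHS]mpolyE.
rewrite (raddf_sum (@mtrunc N)) (raddf_sum (@mwiden N rat)) /=.
apply: eq_big_seq => m /t0 m0; rewrite linearZ /= mwidenZ; congr (_ *: _).
rewrite mpolyXE_id !rmorph_prod !big_ord_recr /= m0 expr0 !rmorph1.
congr (_ * _); apply: eq_bigr => i _; rewrite !rmorphXn /= widen_lift.
by rewrite mtruncXlift mwidenX mnmwiden1 widen_lift.
Qed.

Definition esyms N : N.-tuple {mpoly rat[N]} := [tuple mesym N rat i.+1 | i < N].

Definition sym_coord (f : Lambda) (N : nat) : {mpoly rat[N]} :=
  sval (sym_fundamental (sf_sym f N)).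

Fact sym_coordE f N : sym_coord f N \mPo esyms N = f N.
Proof. by rewrite /sym_coord; case: sym_fundamental => t []. Qed.

Fact sym_coord_uniq f N t : t \mPo esyms N = f N -> sym_coord f N = t.
Proof. by rewrite -sym_coordE => /msym_fundamental_un. Qed.

Fact mtrunc_mwiden_esyms N (t : {mpoly rat[N]}) :
  mtrunc (mwiden t \mPo esyms N.+1) = t \mPo esyms N.
Proof.
pose phi : {rmorphism {mpoly rat[N]} -> {mpoly rat[N]}} :=
  @mtrunc N \o comp_mpoly (esyms N.+1) \o @mwiden N rat.
apply: (@mpoly_rmorph_ext N _ phi (comp_mpoly (esyms N))) => [c|i] /=.
  by rewrite mwidenC /mtrunc !comp_mpolyC.
rewrite mwidenX mnmwiden1 /= !comp_mpolyXU -!tnth_nth !tnth_mktuple /=.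
by rewrite -!e_mesym sf_trunc.
Qed.

Fact sym_coord_mwiden f N : (msize (f N.+1) <= N.+1)%N ->
  sym_coord f N.+1 = mwiden (sym_coord f N).
Proof.
move=> le_f; have t0 : mwiden (mtrunc (sym_coord f N.+1)) = sym_coord f N.+1.
  apply: mwiden_mtrunc => m; rewrite /sym_coord.
  case: sym_fundamental => t /= [_ le_t] /(mmeasure_mnm_lt mnmwgt) lt_m.
  have := leq_trans lt_m (leq_trans le_t le_f); rewrite ltnS.
  rewrite /= /mnmwgt big_ord_recr /=; case: (m ord_max) => // k.
  by rewrite mulSn addnCA -ltn_subRL subnn.
rewrite -t0; congr (mwiden _); symmetry; apply: sym_coord_uniq.
by rewrite -mtrunc_mwiden_esyms t0 sym_coordE sf_trunc.
Qed.

Variable a : nat -> Lambda.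

Definition sym_eval (N : nat) : {mpoly rat[N]} -> Lambda :=
  mmap (in_alg Lambda) (fun i : 'I_N => a i.+1).

HB.instance Definition _ N := GRing.RMorphism.copy (@sym_eval N)
  (mmap (in_alg Lambda) (fun i : 'I_N => a i.+1)).

Fact sym_evalZ N c (t : {mpoly rat[N]}) : sym_eval (c *: t) = c *: sym_eval t.
Proof. by rewrite /sym_eval mmapZ /= mulr_algl. Qed.

Fact sym_evalX N (i : 'I_N) : sym_eval 'X_i = a i.+1.
Proof. by rewrite /sym_eval mmapX mmap1U. Qed.

Fact sym_eval_mwiden N (t : {mpoly rat[N]}) : sym_eval (mwiden t) = sym_eval t.
Proof.
pose phi : {rmorphism {mpoly rat[N]} -> Lambda} :=
  @sym_eval N.+1 \o @mwiden N rat.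
apply: (@mpoly_rmorph_ext N _ phi (@sym_eval N)) => [c|i] /=.
  by rewrite mwidenC /sym_eval !mmapC.
by rewrite mwidenX mnmwiden1 /= !sym_evalX.
Qed.

Definition sf_degree (f : Lambda) : nat := sval (cid (sf_bounded f)).

Fact sf_degreeP f n : (msize (f n) <= sf_degree f)%N.
Proof. by rewrite /sf_degree; case: cid. Qed.

Definition sym_hom (f : Lambda) : Lambda :=
  sym_eval (sym_coord f (sf_degree f)).

Fact sym_eval_coord f D : (forall n, (msize (f n) <= D)%N) ->
  forall N, (D <= N)%N -> sym_eval (sym_coord f N) = sym_eval (sym_coord f D).
Proof.
move=> leD; elim=> [|N IH]; first by rewrite leqn0 => /eqP->.
rewrite leq_eqVlt => /predU1P[-> //|ltN].
by rewrite sym_coord_mwiden ?sym_eval_mwiden ?IH // (leq_trans (leD _)) // ltnW.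
Qed.

Fact sym_homE f D N : (forall n, (msize (f n) <= D)%N) -> (D <= N)%N ->
  sym_hom f = sym_eval (sym_coord f N).
Proof.
move=> leD leN; have := sym_eval_coord (@sf_degreeP f).
move=> /(_ _ (leq_maxl _ N)); rewrite /sym_hom => <-.
have := sym_eval_coord leD; move=> evD; rewrite !evD //.
by rewrite (leq_trans leN) ?leq_maxr.
Qed.

Fact sym_hom_zmod : zmod_morphism sym_hom.
Proof.
move=> f g; pose N := (sf_degree f + sf_degree g + sf_degree (f - g)%R)%N.
rewrite (@sym_homE f _ N (@sf_degreeP f)) ?(@sym_homE g _ N (@sf_degreeP g));
  rewrite ?(@sym_homE (f - g) _ N (@sf_degreeP _)) /N; try lia.
rewrite -raddfB /=; congr sym_eval; apply: sym_coord_uniq.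
by rewrite raddfB /= !sym_coordE.
Qed.

HB.instance Definition _ :=
  GRing.isZmodMorphism.Build Lambda Lambda sym_hom sym_hom_zmod.

Fact sym_hom_monoid : monoid_morphism sym_hom.
Proof.
split=> [|f g].
  rewrite /sym_hom (_ : sym_coord 1 _ = 1) ?rmorph1 //.
  by apply: sym_coord_uniq; rewrite rmorph1.
pose N := (sf_degree f + sf_degree g + sf_degree (f * g)%R)%N.
rewrite (@sym_homE f _ N (@sf_degreeP f)) ?(@sym_homE g _ N (@sf_degreeP g));
  rewrite ?(@sym_homE (f * g) _ N (@sf_degreeP _)) /N; try lia.
rewrite -rmorphM /=; congr sym_eval; apply: sym_coord_uniq.
by rewrite rmorphM /= !sym_coordE.
Qed.

HB.instance Definition _ :=
  GRing.isMonoidMorphism.Build Lambda Lambda sym_hom sym_hom_monoid.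

Fact sym_hom_scale : scalable sym_hom.
Proof.
move=> c f; pose N := (sf_degree f + sf_degree (c *: f)%R)%N.
rewrite (@sym_homE f _ N (@sf_degreeP f));
  rewrite ?(@sym_homE (c *: f) _ N (@sf_degreeP _)) /N; try lia.
rewrite -sym_evalZ; congr sym_eval; apply: sym_coord_uniq.
by rewrite linearZ /= sym_coordE.
Qed.

HB.instance Definition _ :=
  GRing.isScalable.Build rat Lambda Lambda *:%R sym_hom sym_hom_scale.

Lemma sym_hom_e : a 0 = 1 -> forall n, sym_hom (e_ n) = a n.
Proof.
move=> a0 [|n]; first by rewrite /e_ /E_ser /Hd_ser hd0 rmorph1 a0.
rewrite (@sym_homE (e_ n.+1) n.+2 n.+2 _ (leqnn _)); last first.
  by move=> N; apply: Hd_poly_bounded.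
have lt_n : (n < n.+2)%N by [].
rewrite (@sym_coord_uniq _ _ 'X_(Ordinal lt_n)) ?sym_evalX //.
by rewrite comp_mpolyXU -tnth_nth tnth_mktuple e_mesym.
Qed.

End SymHom.

Lemma sym_hom_uniq (a : nat -> Lambda) (phi : {lrmorphism Lambda -> Lambda}) :
  (forall n, phi (e_ n) = a n) -> phi =1 sym_hom a.
Proof.
move=> phi_e f; set D := sf_degree f.
have fE : sym_eval e_ (sym_coord f D) = f.
  have geD M : (D <= M)%N -> sym_eval e_ (sym_coord f D) M = f M.
    move=> leM; rewrite -(sym_eval_coord e_ (@sf_degreeP f) leM) -[RHS]sym_coordE.
    pose psi : {rmorphism {mpoly rat[M]} -> {mpoly rat[M]}} :=
      sf_at M \o @sym_eval e_ M.
    rewrite -[LHS]/(psi _).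
    apply: (@mpoly_rmorph_ext M _ psi (comp_mpoly (esyms M))) => [c|i] /=.
      by rewrite /sym_eval mmapC comp_mpolyC linearZ rmorph1 /= -mul_mpolyC mulr1.
    by rewrite sym_evalX comp_mpolyXU -tnth_nth tnth_mktuple /sf_at e_mesym.
  have down (g h : Lambda) M k : g (M + k)%N = h (M + k)%N -> g M = h M.
    elim: k => [|k IH]; first by rewrite addn0.
    by rewrite addnS => /(congr1 (@mtrunc _)); rewrite !sf_trunc.
  by apply: LambdaP => M; apply: (down _ _ _ D); rewrite geD ?leq_addl.
rewrite -[in LHS]fE.
pose psi : {rmorphism {mpoly rat[D]} -> Lambda} := phi \o @sym_eval e_ D.
apply: (@mpoly_rmorph_ext D _ psi (@sym_eval a D)) => [c|i] /=.
  by rewrite /sym_eval !mmapC linearZ /= rmorph1.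
by rewrite !sym_evalX phi_e.
Qed.

Definition omegad (d : nat) : {lrmorphism Lambda -> Lambda} := sym_hom (hd d).
Definition omega : {lrmorphism Lambda -> Lambda} := sym_hom h_.

Lemma omegad_e d n : omegad d (e_ n) = hd d n.
Proof. by rewrite [LHS]sym_hom_e ?hd0. Qed.

Lemma omega_e n : omega (e_ n) = h_ n.
Proof. by rewrite [LHS]sym_hom_e ?h_0. Qed.

(* Main.v *)
(** The power sums generate Lambda over the rationals and are common
    eigenvectors of omega and of all omega^[d].  Indeed, if t u'(t) = q(t) u(t),
    then q is determined by u, and each factor 1 + xt + ... + (xt)^d of
    H^[d](t) has logarithmic derivative q(t) = sum_k c_k x^k t^k with c_k a
    rational number which depends only on d and k; hence
    t H^[d]'(t) = (sum_k c_k p_k t^k) H^[d](t).  Comparing with the case d = 1,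
    where c_k = +1 or -1, shows that omega^[d] multiplies p_k by a scalar. *)
Require Import Defs.
From mathcomp Require Import all_boot all_order all_algebra.
From mathcomp Require Import perm ring zify boolp.
From mathcomp Require Import mpoly.

Set Implicit Arguments.
Unset Strict Implicit.
Unset Printing Implicit Defensive.

Import GRing.Theory.
Local Open Scope ring_scope.

(** * Logarithmic derivatives of polynomials and of power series *)

Section LogarithmicDerivative.

Variable A : comNzRingType.
Implicit Types (p q r s : {poly A}) (u v w : nat -> A) (n : nat).

(** Congruence modulo t^(n+1): power series are handled through polynomial truncations, where
    [deriv] and the ring laws are available. *)
Definition eqp_upto n p q := forall j, (j <= n)%N -> p`_j = q`_j.

Lemma eqp_upto_mul n p q r s :
  eqp_upto n p q -> eqp_upto n r s -> eqp_upto n (p * r) (q * s).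
Proof.
move=> pq rs j lejn; rewrite !coefM; apply: eq_bigr => i _.
by rewrite pq ?rs // (leq_trans _ lejn) ?leq_subr ?leq_ord.
Qed.

(** The factor ['X] makes truncation harmless: coefficient j of t p'(t) involves only coefficient j
    of [p]. *)
Definition logder n p q := eqp_upto n ('X * p^`()) (q * p).

Lemma coefXderiv p j : ('X * p^`())`_j = p`_j *+ j.
Proof. by rewrite coefXM coef_deriv; case: j => [|j] //=; rewrite mulr0n. Qed.

Lemma logder1 n : logder n 1 0.
Proof. by move=> [|j] _; rewrite mul0r coefXderiv coef1 coef0 ?mul0rn. Qed.

Lemma logderM n p q r s :
  logder n p q -> logder n r s -> logder n (p * r) (q + s).
Proof.
move=> pq rs j lejn; rewrite derivM.
have -> : 'X * (p^`() * r + p * r^`()) = ('X * p^`()) * r + p * ('X * r^`()).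
  by ring.
have -> : (q + s) * (p * r) = (q * p) * r + p * (s * r) by ring.
by rewrite !coefD; congr (_ + _); apply: (eqp_upto_mul _ _ lejn).
Qed.

(** Differentiating p r = 1 gives p (t r') = - q modulo t^(n+1); multiplying by r isolates t r'. *)
Lemma logder_inv n p q r :
  logder n p q -> eqp_upto n (p * r) 1 -> logder n r (- q).
Proof.
move=> pq pr1.
have d0 : eqp_upto n ('X * (p * r)^`()) 0.
  by move=> [|j] le_jn; rewrite coefXderiv pr1 // coef1 coef0 ?mul0rn.
have pXr : eqp_upto n (p * ('X * r^`())) (- q).
  move=> j le_jn; have := d0 _ le_jn.
  have -> : 'X * (p * r)^`() = ('X * p^`()) * r + p * ('X * r^`()).
    by rewrite derivM; ring.
  rewrite coefD (eqp_upto_mul pq (fun _ _ => erefl) le_jn) -mulrA.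
  rewrite (eqp_upto_mul (fun _ _ => erefl) pr1 le_jn) mulr1 coef0 coefN => /eqP.
  by rewrite addrC addr_eq0 => /eqP.
move=> j le_jn; rewrite -(eqp_upto_mul pXr (fun _ _ => erefl) le_jn).
have -> : p * ('X * r^`()) * r = (p * r) * ('X * r^`()) by ring.
by rewrite (eqp_upto_mul pr1 (fun _ _ => erefl) le_jn) mul1r.
Qed.

(** Newton's identities, that is, t u'(t) = v(t) u(t). *)
Definition newton u v := forall n, u n *+ n = ser_mul v u n.

Lemma coefM_poly n u v j : (j <= n)%N ->
  (\poly_(i < n.+1) u i * \poly_(i < n.+1) v i)`_j = ser_mul u v j.
Proof.
move=> le_jn; rewrite coefM; apply: eq_bigr => i _.
by rewrite !coef_poly !ltnS (leq_trans (leq_subr _ _) le_jn)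
  (leq_trans (leq_ord i) le_jn).
Qed.

Lemma newton_logder u v :
  newton u v <->
  forall n, logder n (\poly_(i < n.+1) u i) (\poly_(i < n.+1) v i).
Proof.
split=> [uv n j le_jn|uv n].
  by rewrite coefXderiv coef_poly ltnS le_jn uv coefM_poly.
by have := uv n n (leqnn n); rewrite coefXderiv coef_poly ltnSn coefM_poly.
Qed.

(** As u_0 = 1, coefficient n of v u is v_n plus terms in earlier v_i, so v is determined
    recursively. *)
Lemma newton_uniq u v w : u 0%N = 1 -> newton u v -> newton u w -> v =1 w.
Proof.
move=> u0 uv uw n; elim/ltn_ind: n => n IH.
have := etrans (esym (uv n)) (uw n).
rewrite /ser_mul !big_ord_recr /= subnn u0 !mulr1.
by under eq_bigr => i _ do rewrite IH //; apply: addrI.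
Qed.

Lemma newton_negt u v : newton u v -> newton (ser_negt u) (ser_negt v).
Proof.
move=> uv n; rewrite /ser_negt -mulrnAr uv mulr_sumr; apply: eq_bigr => i _.
by rewrite -{1}(subnKC (leq_ord i)) exprD; ring.
Qed.

Lemma newton_inv u v :
  u 0%N = 1 -> newton u v -> newton (ser_inv u) (fun i => - v i).
Proof.
move=> u0 /newton_logder uv; apply/newton_logder => n.
have -> : \poly_(i < n.+1) - v i = - \poly_(i < n.+1) v i.
  by apply/polyP => i; rewrite coefN !coef_poly; case: ifP; rewrite ?oppr0.
apply: logder_inv (uv n) _ => j le_jn.
by rewrite coefM_poly // ser_mulV // coef1.
Qed.

End LogarithmicDerivative.

(** * Ring morphisms applied coefficientwise *)

Section Morphisms.

Variables (A B : comNzRingType) (phi : {rmorphism A -> B}).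
Implicit Types u v : nat -> A.

Lemma newton_map u v :
  newton u v -> newton (ser_map phi u) (ser_map phi v).
Proof.
move=> uv n; rewrite /ser_map -rmorphMn uv rmorph_sum.
by apply: eq_bigr => i _; rewrite rmorphM.
Qed.

Lemma ser_map_negt u : ser_map phi (ser_negt u) = ser_negt (ser_map phi u).
Proof. by apply/funext => n; rewrite /ser_map /ser_negt rmorphM rmorph_sign. Qed.

Lemma ser_map_inv u : ser_map phi (ser_inv u) = ser_inv (ser_map phi u).
Proof.
apply/funext => n; rewrite /ser_map /ser_inv -coef_map rmorph_sum /=.
congr (nth 0 (polyseq _) n); apply: eq_bigr => k _; rewrite rmorphXn rmorphB rmorph1 /=.
congr ((1 - _) ^+ _); apply/polyP => i; rewrite coef_map !coef_poly.
by case: ifP => _ //; rewrite raddf0.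
Qed.

End Morphisms.

(** * Logarithmic derivative of one factor of H^[d](t) *)

(* Equals 1 - (d + 1) if d + 1 divides k and 1 otherwise, for k > 0; it is 0
   for k = 0.  In this form the sums of consecutive values telescope. *)
Definition geom_coef (d k : nat) : rat :=
  (k %% d.+1)%:R - (k.-1 %% d.+1)%:R.

Lemma geom_coef0 d : geom_coef d 0 = 0.
Proof. by rewrite /geom_coef subrr. Qed.

Lemma geom_coef1 k : (0 < k)%N -> geom_coef 1 k = - (-1) ^+ k.
Proof.
by case: k => // k _; rewrite /geom_coef !modn2 -signr_odd /=; case: odd.
Qed.

(** This is the case x = 1 of [logder_geom], read off at t^j: only the indices from j - d to j meet
    1 + t + ... + t^d. *)
Lemma sum_geom_coef d j :
  \sum_(i < j.+1 | (j - i <= d)%N) geom_coef d i =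
  if (j <= d)%N then j%:R else 0.
Proof.
rewrite -(big_mkord (fun i => (j - i <= d)%N)).
rewrite (big_cat_nat (leq0n (j - d)%N)) ?leqW ?leq_subr //=.
rewrite big_nat_cond big1 ?add0r => [|i]; last by lia.
rewrite big_nat_cond (eq_bigl (fun i => (j - d <= i < j.+1)%N)); last first.
  by move=> i /=; lia.
rewrite -big_nat (telescope_sumr_eq (fun i => (i.-1 %% d.+1)%:R)) ?leqW
  ?leq_subr // => /=.
case: leqP => [le_jd | lt_dj].
  (* Subtraction and predecessor both truncate at 0, so the lower end contributes 0. *)
  by rewrite (eqP (_ : j - d == 0)%N) ?subn_eq0 // mod0n modn_small // subr0.
(* The two ends j and j - d - 1 are congruent modulo d + 1. *)
rewrite -subnS -{1}(subnK lt_dj) modnDr; exact: subrr.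
Qed.

(** Every term in the coefficient of t^j carries x^j, which leaves a scalar identity. *)
Lemma logder_geom (A : comAlgType rat) (x : A) d n :
  logder n (\poly_(j < d.+1) x ^+ j)
           (\poly_(i < n.+1) (geom_coef d i *: x ^+ i)).
Proof.
move=> j le_jn; rewrite coefXderiv coef_poly ltnS coefM.
transitivity ((\sum_(i < j.+1 | (j - i <= d)%N) geom_coef d i) *: x ^+ j).
  by rewrite sum_geom_coef; case: ifP; rewrite ?scaler_nat ?scale0r ?mul0rn.
rewrite scaler_suml [LHS]big_mkcond; apply: eq_bigr => i _.
rewrite !coef_poly !ltnS (leq_trans (leq_ord i) le_jn); case: ifP => _.
  by rewrite -scalerAl -exprD subnKC ?leq_ord.
by rewrite mulr0.
Qed.

(** * Power sums and the logarithmic derivatives of H^[d](t) and H(t) *)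

(* The power sum p_k in N variables, except that p_0 is set to 0, since N is
   not compatible with truncation. *)
Definition psum_poly (k N : nat) : {mpoly rat[N]} :=
  if k is 0 then 0 else \sum_(i < N) 'X_i ^+ k.

Fact psum_poly_sym k N : psum_poly k N \is symmetric.
Proof.
case: k => [|k]; first by rewrite rpred0.
apply/issymP => s; rewrite rmorph_sum /= [RHS](reindex_inj (@perm_inj _ s)) /=.
apply: eq_bigr => i _; rewrite rmorphXn /= msymX; congr (_ ^+ _).
congr 'X_[_]; apply/mnmP => j; rewrite !mnmE.
by rewrite -(inj_eq (@perm_inj _ s)) permKV.
Qed.

Fact psum_poly_trunc k N : mtrunc (psum_poly k N.+1) = psum_poly k N.
Proof.
case: k => [|k]; first by rewrite raddf0.
rewrite /psum_poly big_ord_recr raddfD raddf_sum /= !rmorphXn /=.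
rewrite {2}/mtrunc comp_mpolyXU -tnth_nth tnth_mktuple unlift_none.
rewrite expr0n addr0; apply: eq_bigr => i _.
by rewrite rmorphXn /= widen_lift mtruncXlift.
Qed.

Fact psum_poly_bounded k N : (msize (psum_poly k N) <= k.+1)%N.
Proof.
case: k => [|k]; first by rewrite mmeasure0.
apply: (leq_trans (mmeasure_sum _ _ _ _)); apply/bigmax_leqP => i _.
by rewrite mpolyXn msizeX mdegMn mdeg1 mul1n.
Qed.

Definition psum (k : nat) : Lambda :=
  SymFun (psum_poly_sym k) (psum_poly_trunc k)
    (ex_intro _ k.+1 (psum_poly_bounded k)).

Lemma psum0 : psum 0 = 0.
Proof. exact: LambdaP. Qed.

Lemma logder_Hd_poly d N n :
  logder n (Hd_poly d N)
           (\poly_(i < n.+1) (geom_coef d i *: psum_poly i N)).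
Proof.
rewrite (_ : \poly_(i < n.+1) _ =
  \sum_(k < N) \poly_(i < n.+1) (geom_coef d i *: 'X_k ^+ i)).
  rewrite /Hd_poly; elim/big_rec2: _ => [|k q p _ pq]; first exact: logder1.
  by apply: logderM => //; apply: logder_geom.
apply/polyP => i; rewrite coef_sum coef_poly.
under eq_bigr => k _ do rewrite coef_poly.
case: ifP => _; last by rewrite big1.
case: i => [|i]; last by rewrite scaler_sumr.
(* The powers x_k^0 add up to N whereas [psum_poly 0 N] is 0; the zero coefficient reconciles
   them. *)
by rewrite geom_coef0 scaler0 big1 // => k _; rewrite scale0r.
Qed.

Lemma newton_hd d : newton (hd d) (fun k => geom_coef d k *: psum k).
Proof.
move=> n; apply: LambdaP => N.
rewrite -![sf _ N]/(sf_at N _) raddfMn raddf_sum /=.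
have := logder_Hd_poly d N (leqnn n); rewrite coefXderiv coefM => ->.
by apply: eq_bigr => i _; rewrite coef_poly ltnS leq_ord.
Qed.

(** The signs from t -> -t and from inversion cancel the sign in [geom_coef 1]. *)
Lemma newton_h : newton h_ psum.
Proof.
have e0 : ser_negt E_ser 0%N = 1 by rewrite /ser_negt expr0 mul1r; apply: hd0.
have := newton_inv e0 (newton_negt (newton_hd 1)).
congr newton; apply/funext => -[|k]; rewrite /ser_negt.
  by rewrite psum0 scaler0 mulr0 oppr0.
rewrite geom_coef1 // scaleNr mulrN opprK.
rewrite -[X in X * _]signr_odd -[X in X *: _]signr_odd scaler_sign mulr_sign.
by case: odd; rewrite ?opprK.
Qed.

Lemma psum_eigen (phi : {lrmorphism Lambda -> Lambda}) (c : nat -> rat) :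
  phi (e_ 0) = 1 ->
  newton (ser_map phi e_) (fun k => c k *: psum k) ->
  forall k, phi (psum k) = (geom_coef 1 k * c k) *: psum k.
Proof.
move=> phi0 phi_c [|k]; first by rewrite psum0 rmorph0 scaler0.
have /(_ k.+1) := newton_uniq phi0 (newton_map phi (newton_hd 1)) phi_c.
(* For k > 0 the scalar [geom_coef 1 k] is a sign, hence its own inverse. *)
rewrite /ser_map /= linearZ /= => /(congr1 ( *:%R (geom_coef 1 k.+1))).
by rewrite !scalerA geom_coef1 // mulrNN -expr2 sqrr_sign scale1r.
Qed.

Lemma omegad_psum d k :
  omegad d (psum k) = (geom_coef 1 k * geom_coef d k) *: psum k.
Proof.
apply: psum_eigen; first by rewrite omegad_e hd0.
have -> : ser_map (omegad d) e_ = hd d by apply/funext => n; apply: omegad_e.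
exact: newton_hd.
Qed.

Lemma omega_psum k : omega (psum k) = geom_coef 1 k *: psum k.
Proof.
rewrite (@psum_eigen omega (fun=> 1)) ?mulr1 ?omega_e ?h_0 //.
have -> : ser_map omega e_ = h_ by apply/funext => n; apply: omega_e.
by under eq_fun do rewrite scale1r; apply: newton_h.
Qed.

(** Newton's identities, divided by n, express e_n through power sums and earlier e_i. *)
Lemma lrmorph_psum_ext (phi psi : {lrmorphism Lambda -> Lambda}) :
  (forall k, phi (psum k) = psi (psum k)) -> phi =1 psi.
Proof.
move=> eqp; suff eqe n : phi (e_ n) = psi (e_ n).
  move=> f; rewrite (sym_hom_uniq eqe).
  by rewrite (@sym_hom_uniq (fun n => psi (e_ n)) psi).
elim/ltn_ind: n => -[_|n IH].
  by have -> : e_ 0 = 1 by [exact: hd0]; rewrite !rmorph1.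
have en : e_ n.+1 = n.+1%:R^-1 *:
    \sum_(i < n.+2) (geom_coef 1 i *: psum i) * e_ (n.+1 - i).
  rewrite -[X in _ *: X](newton_hd 1 n.+1) -scaler_nat scalerA mulVf ?scale1r //.
  by rewrite Num.Theory.pnatr_eq0.
rewrite en !linearZ /= !rmorph_sum; congr (_ *: _); apply: eq_bigr => i _.
rewrite !rmorphM /= !linearZ /= eqp; case: i => -[|i] lt_i /=.
  (* The term i = 0 contains e_(n+1) itself, out of reach of the induction, but its coefficient
     vanishes. *)
  by rewrite geom_coef0 !scale0r !mul0r.
by rewrite IH // ltnS subSS leq_subr.
Qed.

(** * Commutation, checked on common eigenvectors *)

Lemma omegad_comm d d' : omegad d \o omegad d' =1 omegad d' \o omegad d.
Proof.
apply: lrmorph_psum_ext => k /=.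
by rewrite !omegad_psum !linearZ /= !omegad_psum !scalerA mulrC.
Qed.

Lemma omegad_omega_comm d : omegad d \o omega =1 omega \o omegad d.
Proof.
apply: lrmorph_psum_ext => k /=.
rewrite omegad_psum omega_psum !linearZ /= omegad_psum omega_psum.
by rewrite !scalerA mulrC.
Qed.

Local Close Scope ring_scope.

Theorem corollary3p3 :
  (forall d d' : nat, 1 <= d -> 1 <= d' ->
     omegad d \o omegad d' =1 omegad d' \o omegad d) /\
  (forall d : nat, 1 <= d ->
     omegad d \o omega =1 omega \o omegad d /\
     [/\ ser_map (omegad d) E_ser = Hd_ser d,
         ser_map omega (Hd_ser d) = ser_inv (ser_negt (Hd_ser d)),
         ser_map omega E_ser = H_ser &
         ser_map (omegad d) H_ser = ser_inv (ser_negt (Hd_ser d))]).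
Proof.
split=> [d d' _ _|d _]; first exact: omegad_comm.
split; first exact: omegad_omega_comm.
have dE : ser_map (omegad d) E_ser = Hd_ser d.
  by apply/funext => n; apply: omegad_e.
have oE : ser_map omega E_ser = H_ser by apply/funext => n; apply: omega_e.
have dH : ser_map (omegad d) H_ser = ser_inv (ser_negt (Hd_ser d)).
  by rewrite ser_map_inv ser_map_negt dE.
(* The remaining equation becomes the commuting square evaluated at E(t). *)
split=> //; rewrite -dH -dE -oE; apply/funext => n.
exact: esym (omegad_omega_comm d _).
Qed.
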